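(* Let $P$ be a normal logic program and $S$ a nonempty set of two-valued interpretations of $P$. Then $S$ is a $\subseteq$-minimal supported trap set of $P$ if and only if $\Pi^{I}_{P}\uparrow\alpha_I = S$ for every $I\in S$.
   Context: Fix a first-order language with finitely many constant, function and predicate symbols. A normal logic program (NLP) $P$ is a finite set of rules $p \leftarrow p_1,\dots,p_m, \mathord{\sim} p_{m+1},\dots,\mathord{\sim} p_k$ ($k\ge m\ge 0$). $\mathrm{HB}(P)$ is its Herbrand base (possibly infinite), $\mathrm{gr}(P)$ its ground instantiation; for a ground rule $r$, $\mathrm{bf}(r)=\bigwedge_{v\in B^+(r)}v\wedge\bigwedge_{v\in B^-(r)}\neg v$ with $B^+(r)$, $B^-(r)$ the positive and negative body atoms. Two-valued interpretations are subsets of $\mathrm{HB}(P)$. For a two-valued $I$, $T_P(I)$ is the set of atoms $a$ such that $I$ satisfies $\mathrm{bf}(r)$ for some $r\in\mathrm{gr}(P)$ with head $a$. A nonempty set $S$ of two-valued interpretations is a supported trap set if $\{T_P(J):J\in S\}\subseteq S$; it is $\subseteq$-minimal if no proper subset is a supported trap set. For a two-valued $I$, the supported reachable closure is defined by transfinite recursion: $\Pi^I_P\uparrow 0=\{I\}$, $\Pi^I_P\uparrow(\alpha+1)=\Pi^I_P\uparrow\alpha\cup\{T_P(J): J\in\Pi^I_P\uparrow\alpha\}$, and $\Pi^I_P\uparrow\beta=\bigcup_{\alpha<\beta}\Pi^I_P\uparrow\alpha$ for limit ordinals $\beta$. This is a $\subseteq$-increasing ordinal-indexed family of subsets of the set of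 two-valued interpretations, hence eventually constant; $\alpha_I$ denotes the least ordinal with $\Pi^I_P\uparrow(\alpha_I+1)=\Pi^I_P\uparrow\alpha_I$. *)

(* Defs.v *)
From Stdlib Require List.
From mathcomp Require Import all_boot.
From mathcomp Require Import boolp classical_sets functions cardinality.

Set Implicit Arguments.
Unset Strict Implicit.
Unset Printing Implicit Defensive.

Local Open Scope classical_set_scope.

(** * Syntax *)

Record language := Language {
  const : finType;
  func : finType;
  func_ar : func -> nat;
  pred_sym : finType;
  pred_ar : pred_sym -> nat
}.

(* Terms, atoms and rules are parameterized by the type [V] of variables:
   [V := nat] for the syntax of programs, [V := void] for ground syntax. *)
Inductive term (L : language) (V : Type) : Type :=
| Var of V
| Const of const L
| App (f : func L) of {ffun 'I_(func_ar f) -> term L V}.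

Arguments Var {L V}.
Arguments Const {L V}.
Arguments App {L V}.

Fixpoint term_subst (L : language) (V W : Type) (s : V -> term L W)
    (t : term L V) : term L W :=
  match t with
  | Var x => s x
  | Const c => Const c
  | App f ts => App f [ffun i => term_subst s (ts i)]
  end.

Record atom (L : language) (V : Type) := Atom {
  atom_pred : pred_sym L;
  atom_args : {ffun 'I_(pred_ar atom_pred) -> term L V}
}.

Definition atom_subst (L : language) (V W : Type) (s : V -> term L W)
    (a : atom L V) : atom L W :=
  Atom [ffun i => term_subst s (atom_args a i)].

(* [Rule p [:: p1; ...; pm] [:: p(m+1); ...; pk]] stands for
   p <- p1, ..., pm, ~p(m+1), ..., ~pk *)
Record rule (L : language) (V : Type) := Rule {
  head : atom L V;
  pos_body : seq (atom L V);
  neg_body : seq (atom L V)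
}.

Definition rule_subst (L : language) (V W : Type) (s : V -> term L W)
    (r : rule L V) : rule L W :=
  Rule (atom_subst s (head r)) (map (atom_subst s) (pos_body r))
    (map (atom_subst s) (neg_body r)).

Record program (L : language) := Program {
  rules : set (rule L nat);
  rules_finite : finite_set rules
}.

(** * Herbrand semantics *)

Definition herbrand_base (L : language) : Type := atom L void.

Definition ground_rule (L : language) : Type := rule L void.

Definition embed_ground (L : language) (V : Type) (r : ground_rule L)
    : rule L V :=
  rule_subst (fun v : void => match v with end) r.

(* Ground instances are the variable-free instances. Substituting ground terms
   for all of [nat] would not do: a language without constants has no ground
   term, yet a rule in which no variable occurs is its own ground instance. *)
Definition gr (L : language) (P : program L) : set (ground_rule L) :=
  [set g | exists r : rule L nat, exists s : nat -> term L nat,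
     rules P r /\ embed_ground nat g = rule_subst s r].

Definition Bpos (L : language) (r : ground_rule L) : set (herbrand_base L) :=
  [set v | List.In v (pos_body r)].

Definition Bneg (L : language) (r : ground_rule L) : set (herbrand_base L) :=
  [set v | List.In v (neg_body r)].

Definition interp (L : language) : Type := set (herbrand_base L).

Definition sat_bf (L : language) (I : interp L) (r : ground_rule L) : Prop :=
  (forall v, Bpos r v -> I v) /\ (forall v, Bneg r v -> ~ I v).

Definition TP (L : language) (P : program L) (I : interp L) : interp L :=
  [set a | exists r, [/\ gr P r, head r = a & sat_bf I r]].

Definition supported_trap_set (L : language) (P : program L)
    (S : set (interp L)) : Prop :=
  S !=set0 /\ TP P @` S `<=` S.

Definition min_supported_trap_set (L : language) (P : program L)
    (S : set (interp L)) : Prop :=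
  supported_trap_set P S /\
  (forall S' : set (interp L), S' `<` S -> ~ supported_trap_set P S').

(** * Ordinals *)

(* [Osup f] denotes the least ordinal strictly above all the [f i]. Every
   ordinal b is of this form, with [f] enumerating the ordinals below b; several
   trees may denote the same ordinal, so equality of ordinals is [oeq]. *)
Inductive ord : Type := Osup (A : Type) (f : A -> ord).

Fixpoint ole (a b : ord) {struct a} : Prop :=
  match a, b with
  | Osup A f, Osup B g => forall i, exists j, ole (f i) (g j)
  end.

Definition olt (a b : ord) : Prop :=
  match b with Osup B g => exists j, ole a (g j) end.

Definition oeq (a b : ord) : Prop := ole a b /\ ole b a.

Definition osucc (a : ord) : ord := Osup (fun _ : unit => a).

Definition is_zero (a : ord) : Prop := forall b, ~ olt b a.

Definition is_succ (a b : ord) : Prop := oeq b (osucc a).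

Definition is_limit (b : ord) : Prop :=
  ~ is_zero b /\ forall a, ~ is_succ a b.

Lemma ole_refl a : ole a a.
Proof. by elim: a => A f IH /= i; exists i. Qed.

Lemma ole_trans a b c : ole a b -> ole b c -> ole a c.
Proof.
elim: a b c => A f IH [B g] [C h] /= ab bc i.
have [j ij] := ab i; have [k jk] := bc j.
by exists k; apply: IH ij jk.
Qed.

Lemma oltW a b : olt a b -> ole a b.
Proof.
elim: a b => A f IH [B g] /= [j aj] i.
exists j; apply: IH; case: (g j) aj => C h /=; exact.
Qed.

Lemma olt_le_trans a b c : olt a b -> ole b c -> olt a c.
Proof.
case: b c => B g [C h] /= [j aj] bc; have [k jk] := bc j.
by exists k; apply: ole_trans aj jk.
Qed.

Lemma ole_lt_trans a b c : ole a b -> olt b c -> olt a c.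
Proof.
by case: c => C h /= ab [k bk]; exists k; apply: ole_trans ab bk.
Qed.

Lemma olt_wf : well_founded olt.
Proof.
suff H b : forall a, ole a b -> Acc olt a by move=> a; apply: H (ole_refl a).
elim: b => B g IH a ab; constructor => c ca.
have /= [j cj] := olt_le_trans ca ab.
exact: IH cj.
Qed.

Lemma ole_or_lt a b : ole a b \/ olt b a.
Proof.
elim: a b => A f IH [B g].
have [ab|/existsNP[i /forallNP ni]] := pselect (ole (Osup f) (Osup g)).
  by left.
right; exists i; move: (IH i) ni; case: (f i) => C h IHi ni /= j.
by have [/ni|] := IHi (g j).
Qed.

Lemma olt_succ a : olt a (osucc a).
Proof. by exists tt; apply: ole_refl. Qed.

Lemma olt_irr a : ~ olt a a.
Proof. by elim/(well_founded_ind olt_wf): a => b IH h; exact: (IH b h h). Qed.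

Lemma olt_succ_le a b : olt a (osucc b) -> ole a b.
Proof. by case. Qed.

Definition onat (n : nat) : ord :=
  iter n osucc (Osup (fun v : void => match v with end)).

Definition omega : ord := Osup onat.

Lemma onat_lt_omega n : olt (onat n) omega.
Proof. by exists n; apply: ole_refl. Qed.

Lemma omega_limit : is_limit omega.
Proof.
split=> [w0|a [wa aw]].
  exact: (w0 (onat 0) (onat_lt_omega 0)).
have /= [n an] := olt_le_trans (olt_succ a) aw.
have nw := onat_lt_omega n.+1.
have na : ole (onat n.+1) a by apply: olt_succ_le; apply: olt_le_trans wa.
apply: (@olt_irr (onat n)).
exact: olt_le_trans (olt_succ (onat n)) (ole_trans na an).
Qed.

(** * The supported reachable closure *)

(* The three clauses of the transfinite recursion, for [b] zero, successor and
   limit; [supp_reach0], [supp_reachS] and [supp_reachL] give them back as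
   equations. *)
Inductive supp_reach (L : language) (P : program L) (I : interp L)
    : ord -> set (interp L) :=
| SRzero b : is_zero b -> supp_reach P I b I
| SRkeep a b J : is_succ a b -> supp_reach P I a J -> supp_reach P I b J
| SRstep a b J : is_succ a b -> supp_reach P I a J ->
    supp_reach P I b (TP P J)
| SRlim a b J : is_limit b -> olt a b -> supp_reach P I a J ->
    supp_reach P I b J.

Lemma zero_not_succ a b : is_zero b -> ~ is_succ a b.
Proof. by move=> b0 [_ ab]; apply: (b0 a); apply: olt_le_trans ab; apply: olt_succ. Qed.

Lemma is_succ_inj a a' b : is_succ a b -> is_succ a' b -> oeq a a'.
Proof.
move=> [ba ab] [ba' ab']; split; apply: olt_succ_le.
  exact: olt_le_trans (olt_succ a) (ole_trans ab ba').
exact: olt_le_trans (olt_succ a') (ole_trans ab' ba).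
Qed.

Lemma oeq_sym a b : oeq a b -> oeq b a.
Proof. by case. Qed.

Lemma oeq_trans a b c : oeq a b -> oeq b c -> oeq a c.
Proof.
by move=> [ab ba] [bc cb]; split; [apply: ole_trans ab bc|apply: ole_trans cb ba].
Qed.

Lemma is_zero_eq a b : oeq a b -> is_zero a -> is_zero b.
Proof. by move=> [_ ba] a0 c cb; apply: (a0 c); apply: olt_le_trans ba. Qed.

Lemma is_limit_eq a b : oeq a b -> is_limit a -> is_limit b.
Proof.
move=> ab [a0 aS]; split=> [b0|c bc].
  by apply: a0; apply: is_zero_eq b0; apply: oeq_sym.
by apply: (aS c); apply: oeq_trans bc.
Qed.

Section Recursion.
Variables (L : language) (P : program L) (I : interp L).

Lemma supp_reach_eq a b : oeq a b -> supp_reach P I a = supp_reach P I b.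
Proof.
suff H c d : oeq c d -> supp_reach P I c `<=` supp_reach P I d.
  by move=> ab; apply/seteqP; split; apply: H => //; apply: oeq_sym.
move=> cd J cJ; case: cJ cd => {c J}.
- by move=> c c0 cd; apply: SRzero; apply: is_zero_eq c0.
- move=> a' c J ac aJ cd; apply: SRkeep aJ.
  by apply: oeq_trans ac; apply: oeq_sym.
- move=> a' c J ac aJ cd; apply: SRstep aJ.
  by apply: oeq_trans ac; apply: oeq_sym.
- move=> a' c J cl ac aJ cd; apply: SRlim aJ; first exact: is_limit_eq cl.
  by case: cd => cd _; apply: olt_le_trans cd.
Qed.

Lemma supp_reach0 b : is_zero b -> supp_reach P I b = [set I].
Proof.
move=> b0; apply/seteqP; split=> [J bJ|_ ->]; last exact: SRzero.
case: bJ b0 => //= [a c K ac _ c0|a c K ac _ c0|a c K _ ac _ c0].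
- by case: (zero_not_succ c0 ac).
- by case: (zero_not_succ c0 ac).
- by case: (c0 a ac).
Qed.

Lemma supp_reachS a b : is_succ a b ->
  supp_reach P I b = supp_reach P I a `|` TP P @` supp_reach P I a.
Proof.
move=> ab; apply/seteqP; split=> [J bJ|J]; last first.
  by case=> [aJ|[K aK <-]]; [apply: SRkeep aJ|apply: SRstep aK].
case: bJ ab => {b J}.
- by move=> b b0 ab; case: (zero_not_succ b0 ab).
- by move=> c b J cb cJ ab; left; rewrite (supp_reach_eq (is_succ_inj ab cb)).
- move=> c b J cb cJ ab; right; exists J => //.
  by rewrite (supp_reach_eq (is_succ_inj ab cb)).
- by move=> c b J [_ bS] _ _ ab; case: (bS a ab).
Qed.

Lemma supp_reachL b : is_limit b ->
  supp_reach P I b = \bigcup_(a in [set a | olt a b]) supp_reach P I a.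
Proof.
move=> bl; apply/seteqP; split=> [J bJ|J [a /= ab aJ]]; last exact: SRlim aJ.
case: bJ bl => {b J}.
- by move=> b b0 [bn0 _].
- by move=> a b J ab _ [_ bS]; case: (bS a ab).
- by move=> a b J ab _ [_ bS]; case: (bS a ab).
- by move=> a b J _ ab aJ _; exists a.
Qed.

Lemma supp_reach_mono a b : ole a b -> supp_reach P I a `<=` supp_reach P I b.
Proof.
elim/(well_founded_ind olt_wf): b a => b IH a ab.
have [ba|ab'] := ole_or_lt b a.
  by rewrite (supp_reach_eq (conj ab ba)).
have [[c cb]|bS] := pselect (exists c, is_succ c b).
  rewrite (supp_reachS cb) => J aJ; left; move: J aJ; apply: IH.
    by case: cb => _ cb; apply: olt_le_trans cb; apply: olt_succ.
  by apply: olt_succ_le; case: cb => bc _; apply: olt_le_trans bc.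
move=> J aJ; apply: (SRlim _ ab' aJ); split=> [b0|c cb]; last by apply: bS; exists c.
exact: (b0 a ab').
Qed.

Definition is_closed_at (a : ord) : Prop :=
  supp_reach P I (osucc a) = supp_reach P I a.

Definition is_closure_ordinal (a : ord) : Prop :=
  is_closed_at a /\ forall b, is_closed_at b -> ole a b.

Lemma closed_at_ex : exists a, is_closed_at a.
Proof.
exists omega; rewrite /is_closed_at (@supp_reachS omega (osucc omega)); last first.
  by split; apply: ole_refl.
apply/seteqP; split=> [J [//|[K + <-]]|J]; last by left.
rewrite (supp_reachL omega_limit) => -[a /= [n an] aK].
exists (onat n.+1) ; first exact: onat_lt_omega.
rewrite (@supp_reachS (onat n) (onat n.+1)); last by split; apply: ole_refl.
by right; exists K => //; apply: supp_reach_mono aK.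
Qed.

Lemma closure_ordinal_ex : exists a, is_closure_ordinal a.
Proof.
have [a] := closed_at_ex; elim/(well_founded_ind olt_wf): a => a IH aC.
have [[b [ba bC]]|nb] := pselect (exists b, olt b a /\ is_closed_at b).
  exact: IH ba bC.
exists a; split=> // b bC; have [//|ba] := ole_or_lt a b.
by case: nb; exists b.
Qed.

(* Unique up to [oeq], which [supp_reach] respects by [supp_reach_eq]. *)
Definition closure_ordinal : ord := sval (cid closure_ordinal_ex).

Lemma closure_ordinalP : is_closure_ordinal closure_ordinal.
Proof. exact: svalP. Qed.

End Recursion.

(* Main.v *)
Require Import Defs.
From mathcomp Require Import all_boot.
From mathcomp Require Import boolp classical_sets.

Local Open Scope classical_set_scope.

(** The closure of [I] is the least set of interpretations that contains [I]
    and is stable under [TP P]. Hence it lies in every trap set containing [I],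
    and a trap set is minimal exactly when it is the closure of each of its
    members. *)

Lemma supp_reach_self (L : language) (P : program L) (I : interp L) (a : ord) :
  supp_reach P I a I.
Proof.
have z0 : is_zero (onat 0) by move=> b /= [[]].
have za : ole (onat 0) a by case: a => A f /= [].
by apply: (supp_reach_mono za); apply: SRzero.
Qed.

(** By induction on membership: beyond [I], only [SRstep] yields new interpretations, and [T]
    absorbs these. *)
Lemma supp_reach_sub (L : language) (P : program L) (I : interp L)
    (T : set (interp L)) (a : ord) :
  T I -> TP P @` T `<=` T -> supp_reach P I a `<=` T.
Proof.
move=> TI TT J; elim=> // b c K _ _ TK.
by apply: TT; exists K.
Qed.

(** [TP P] leads at most one stage further, and past the closure ordinal that stage adds nothing. *)
Lemma closure_trap_set (L : language) (P : program L) (I : interp L) :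
  supported_trap_set P (supp_reach P I (closure_ordinal P I)).
Proof.
split; first by exists I; apply: supp_reach_self.
have [closed _] := closure_ordinalP P I.
move=> _ [J IJ <-]; rewrite -closed.
by apply: SRstep IJ; split; apply: ole_refl.
Qed.

Theorem theoremB2 (L : language) (P : program L) (S : set (interp L))
    (S_nonempty : S !=set0) :
  min_supported_trap_set P S <->
  (forall I : interp L, S I -> supp_reach P I (closure_ordinal P I) = S).
Proof.
split=> [[[_ trapS] minS] I SI|closS].
  have subS := @supp_reach_sub L P I S (closure_ordinal P I) SI trapS.
  (* Otherwise the closure of [I] is a trap set strictly inside [S]. *)
  apply/seteqP; split=> //; apply: contrapT => nsub.
  by apply: (minS _ (conj subS nsub)); apply: closure_trap_set.
split.
  have [I SI] := S_nonempty.
  by rewrite -(closS I SI); apply: closure_trap_set.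
move=> S' [S'S nSS'] [[J S'J] trapS']; apply: nSS'.
(* [S'] contains the closure of its member [J], which is all of [S]. *)
rewrite -(closS J (S'S J S'J)).
exact: supp_reach_sub.
Qed.
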